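(* For every integer $n \geq 1$, if $\varepsilon_n$ denotes the real number defined by $$H_n = \ln n + \gamma + \frac{1}{2n} - \frac{1}{12n^2} + \varepsilon_n,$$ then $$0 < \varepsilon_n < \frac{1}{4n^3}.$$
   Context: For a positive integer $n$, $H_n := 1 + \frac{1}{2} + \frac{1}{3} + \cdots + \frac{1}{n}$ is the $n$-th harmonic number, $\ln$ is the natural logarithm, and $\gamma = \lim_{n\to\infty} (H_n - \ln n) \approx 0.577\ldots$ is Euler's constant. *)

(* Defs.v *)
From Stdlib Require Import Reals.
From Coquelicot Require Import Coquelicot.
Open Scope R_scope.

Definition harmonic (n : nat) : R := sum_n_m (fun k : nat => / INR k) 1 n.

(* [Lim_seq] is a total limit operator, so this value is meaningful because the
   sequence converges; the term of index 0, where [ln 0] is a junk value, does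
   not affect the limit. *)
Definition euler_gamma : R :=
  real (Lim_seq (fun n : nat => harmonic n - ln (INR n))).

(* Main.v *)
(** Put [e n = H_n - ln n - 1/(2n) + 1/(12n^2)], which tends to [gamma].  It is
    enough that [e n] decreases and [e n - 1/(4n^3)] increases, both strictly.
    With [t = 1/n], the difference [e n - e (n+1)] is a function of [t] that
    vanishes at [0] and has derivative [t^4 / (6 (1+t)^3)]. *)

Require Import Defs.
From Stdlib Require Import Reals Lra Lia.
From Coquelicot Require Import Coquelicot.
Open Scope R_scope.

Lemma pos_of_derive_pos (f df : R -> R) :
  f 0 = 0 ->
  (forall t, 0 <= t -> is_derive f t (df t)) ->
  (forall t, 0 < t -> 0 < df t) ->
  forall t, 0 < t -> 0 < f t.
Proof.
intros f0 Hd Hpos t ht.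
destruct (MVT_cor2 f df 0 t ht) as [c [Hc hc]].
  intros c hc; apply is_derive_Reals, Hd; lra.
rewrite f0 in Hc.
assert (0 < df c * (t - 0)) by (apply Rmult_lt_0_compat; [apply Hpos|]; lra).
lra.
Qed.

(** At [t = 1/n] one has [1/(n+1) = t / (1 + t)]. The new harmonic term [- 1/(n+1)] and the
    correction [+ 1/(2(n+1))] merge into [- t / (2 * (1 + t))]. *)
Definition gap (t : R) : R :=
  ln (1 + t) - t / 2 - t / (2 * (1 + t)) + t ^ 2 / 12
  - t ^ 2 / (12 * (1 + t) ^ 2).

Lemma is_derive_gap (t : R) :
  0 <= t -> is_derive gap t (t ^ 4 / (6 * (1 + t) ^ 3)).
Proof.
intros ht; unfold gap; auto_derive.
  repeat split; try lra; apply Rgt_not_eq; simpl; nra.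
field; lra.
Qed.

Lemma gap_0 : gap 0 = 0.
Proof. unfold gap; rewrite Rplus_0_r, ln_1; field. Qed.

Lemma gap_pos (t : R) : 0 < t -> 0 < gap t.
Proof.
revert t; apply (pos_of_derive_pos _ _ gap_0 is_derive_gap); intros t ht.
apply Rdiv_lt_0_compat; [|apply Rmult_lt_0_compat; [lra|]]; apply pow_lt; lra.
Qed.

(** At [t = 1/n] the right side is [1/(4n^3) - 1/(4(n+1)^3)], so this makes [e n - 1/(4n^3)]
    increase. The difference of the two sides vanishes at 0 and has positive derivative. *)
Lemma gap_lt (t : R) : 0 < t -> gap t < t ^ 3 / 4 - t ^ 3 / (4 * (1 + t) ^ 3).
Proof.
intros ht; apply Rlt_0_minus; revert t ht.
apply (pos_of_derive_pos
  (fun t => t ^ 3 / 4 - t ^ 3 / (4 * (1 + t) ^ 3) - gap t)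
  (fun t => (3 * t ^ 2 / 4 - 3 * t ^ 2 / (4 * (1 + t) ^ 4))
            - t ^ 4 / (6 * (1 + t) ^ 3))).
- rewrite gap_0; field.
- intros t ht.
  apply (is_derive_minus (V := R_NormedModule)
    (fun t => t ^ 3 / 4 - t ^ 3 / (4 * (1 + t) ^ 3))); [|now apply is_derive_gap].
  auto_derive.
    assert (0 < (1 + t) ^ 3) by (apply pow_lt; lra).
    simpl in *; repeat split; lra.
  field; lra.
- intros t ht.
  (* Over the common denominator, [9 * t ^ 2 * ((1 + t) ^ 4 - 1)] loses only [2 * t ^ 4 * (1 + t)],
     so every coefficient stays positive. *)
  replace (_ - _) with
    (t ^ 3 * (36 + 52 * t + 34 * t ^ 2 + 9 * t ^ 3) / (12 * (1 + t) ^ 4))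
    by (field; lra).
  assert (0 < t ^ 2) by (apply pow_lt; lra).
  assert (0 < t ^ 3) by (apply pow_lt; lra).
  apply Rdiv_lt_0_compat; apply Rmult_lt_0_compat; try lra; apply pow_lt; lra.
Qed.

Lemma harmonic_S (n : nat) : harmonic (S n) = harmonic n + / INR (S n).
Proof. unfold harmonic; rewrite sum_n_Sm by lia; reflexivity. Qed.

Definition corrected (n : nat) : R :=
  harmonic n - ln (INR n) - 1 / (2 * INR n) + 1 / (12 * INR n ^ 2).

Lemma corrected_sub_S (n : nat) :
  (1 <= n)%nat -> corrected n - corrected (S n) = gap (/ INR n).
Proof.
intros hn; assert (hp : 0 < INR n) by (apply lt_0_INR; lia).
unfold corrected, gap; rewrite harmonic_S, S_INR.
replace (1 + / INR n) with ((INR n + 1) / INR n) by (field; lra).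
rewrite ln_div by lra.
field; lra.
Qed.

Lemma corrected_decr (n : nat) :
  (1 <= n)%nat -> corrected (S n) < corrected n.
Proof.
intros hn; assert (hp : 0 < INR n) by (apply lt_0_INR; lia).
apply Rlt_0_minus; rewrite corrected_sub_S by easy.
now apply gap_pos, Rinv_0_lt_compat.
Qed.

Lemma corrected_sub_cube_incr (n : nat) :
  (1 <= n)%nat ->
  corrected n - 1 / (4 * INR n ^ 3) < corrected (S n) - 1 / (4 * INR (S n) ^ 3).
Proof.
intros hn; assert (hp : 0 < INR n) by (apply lt_0_INR; lia).
assert (H := gap_lt (/ INR n) (Rinv_0_lt_compat _ hp)).
rewrite <- corrected_sub_S in H by easy.
replace ((/ INR n) ^ 3 / 4 - _) with
  (1 / (4 * INR n ^ 3) - 1 / (4 * INR (S n) ^ 3)) in H; [lra|].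
rewrite S_INR; field; lra.
Qed.

Lemma is_lim_seq_inv_INR_S : is_lim_seq (fun n => / INR (S n)) 0.
Proof.
apply (is_lim_seq_incr_1 (fun n => / INR n)).
apply (is_lim_seq_inv _ p_infty); [apply is_lim_seq_INR|easy].
Qed.

Lemma is_lim_seq_inv_pow_INR_S (c : R) (k : nat) :
  c <> 0 -> is_lim_seq (fun n => 1 / (c * INR (S n) ^ S k)) 0.
Proof.
intros hc.
apply is_lim_seq_ext with (fun n => / c * (/ INR (S n)) ^ S k).
  intros n; rewrite pow_inv.
  assert (INR (S n) ^ S k <> 0) by (apply pow_nonzero, not_0_INR; easy).
  now field.
replace (Finite 0) with (Rbar_mult (/ c) 0) by (simpl; f_equal; ring).
apply is_lim_seq_scal_l.
induction k as [|k IH].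
  apply is_lim_seq_ext with (2 := is_lim_seq_inv_INR_S).
  intros n; ring.
replace 0 with (0 * 0) by ring.
exact (is_lim_seq_mult' _ _ _ _ is_lim_seq_inv_INR_S IH).
Qed.

(** Convergence comes from monotonicity, which also shows that the limit defining [euler_gamma]
    exists. The shift to [S n] starts the sequence at 1. *)
Lemma is_lim_seq_corrected : is_lim_seq (fun n => corrected (S n)) euler_gamma.
Proof.
assert (Hc : ex_finite_lim_seq (fun n => corrected (S n))).
  (* The lower bound is the first term of the increasing sequence [e n - 1/(4n^3)], which lies below
     [e n]. *)
  apply ex_finite_lim_seq_decr with (corrected 1 - 1 / (4 * INR 1 ^ 3)).
    intros n; apply Rlt_le, corrected_decr; lia.
  intros n.
  apply Rle_trans with (corrected (S n) - 1 / (4 * INR (S n) ^ 3)).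
    induction n as [|n IH]; [apply Rle_refl|].
    apply Rle_trans with (1 := IH), Rlt_le, corrected_sub_cube_incr; lia.
  assert (0 < 1 / (4 * INR (S n) ^ 3)); [|lra].
  apply Rdiv_lt_0_compat; [lra|].
  apply Rmult_lt_0_compat; [lra|apply pow_lt, lt_0_INR; lia].
destruct Hc as [l Hl].
assert (Hg : is_lim_seq (fun n => harmonic n - ln (INR n)) l).
  apply is_lim_seq_incr_1.
  (* Undoing the corrections leaves the limit unchanged, since they tend to 0. The exponent 1 puts
     both in the form of [is_lim_seq_inv_pow_INR_S]. *)
  apply is_lim_seq_ext with (fun n => corrected (S n)
    + 1 / (2 * INR (S n) ^ 1) - 1 / (12 * INR (S n) ^ 2)).
    intros n; unfold corrected; rewrite pow_1; ring.
  replace l with (l + 0 - 0) by ring.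
  apply is_lim_seq_minus'; [apply is_lim_seq_plus'|]; [easy| |];
    apply is_lim_seq_inv_pow_INR_S; lra.
unfold euler_gamma; now rewrite (is_lim_seq_unique _ _ Hg).
Qed.

Lemma euler_gamma_lt_corrected (n : nat) :
  (1 <= n)%nat -> euler_gamma < corrected n.
Proof.
(* Comparison with a limit is only weak; one strict step from [n] to [S n] restores strictness. *)
intros hn; apply Rle_lt_trans with (corrected (S n)); [|now apply corrected_decr].
apply (is_lim_seq_decr_compare _ _ is_lim_seq_corrected).
intros k; apply Rlt_le, corrected_decr; lia.
Qed.

Lemma corrected_sub_cube_lt_euler_gamma (n : nat) :
  (1 <= n)%nat -> corrected n - 1 / (4 * INR n ^ 3) < euler_gamma.
Proof.
intros hn.
apply Rlt_le_trans with (1 := corrected_sub_cube_incr n hn).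
apply (is_lim_seq_incr_compare
  (fun n => corrected (S n) - 1 / (4 * INR (S n) ^ 3))).
  replace euler_gamma with (euler_gamma - 0) by ring.
  apply is_lim_seq_minus'; [exact is_lim_seq_corrected|].
  apply is_lim_seq_inv_pow_INR_S; lra.
intros k; apply Rlt_le, corrected_sub_cube_incr; lia.
Qed.

Theorem theorem1 (n : nat) (hn : (1 <= n)%nat) (eps : R)
  (heps : harmonic n = ln (INR n) + euler_gamma + 1 / (2 * INR n)
                       - 1 / (12 * INR n ^ 2) + eps) :
  0 < eps < 1 / (4 * INR n ^ 3).
Proof.
assert (Hlo := euler_gamma_lt_corrected n hn).
assert (Hhi := corrected_sub_cube_lt_euler_gamma n hn).
(* By [heps], [eps] is [corrected n - euler_gamma]. *)
unfold corrected in *; lra.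
Qed.
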